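(* Let $\chi=(\chi_0,\dots,\chi_n)$ be a divisive weight vector, i.e. a vector of positive integers such that $\chi_{j-1}$ divides $\chi_j$ for every $1\leq j\leq n$. Then the weighted projective space $\mathbb{P}(\chi)$ is homeomorphic to an $n$-fold iterated Thom space of complex line bundles over the one-point space $*$.
   Context: Let $T\subset\mathbb{C}$ be the group of unimodular complex numbers. For a vector $\chi=(\chi_0,\dots,\chi_n)$ of positive integers (a weight vector), the weighted projective space $\mathbb{P}(\chi)$ is the orbit space of the unit sphere $S^{2n+1}\subset\mathbb{C}^{n+1}$ under the $T$-action $t\cdot(z_0,\dots,z_n)=(t^{\chi_0}z_0,\dots,t^{\chi_n}z_n)$. Let $X_0,\dots,X_n$ be topological spaces and let $\theta_i$ be a vector bundle over $X_i$ for $0\leq i<n$. Then $X_n$ is an $n$-fold iterated Thom space over $X_0$ if $X_i$ is homeomorphic to the Thom space $\mathrm{Th}(\theta_{i-1})$ for every $1\leq i\leq n$. It is an iterated Thom space of complex line bundles if every $\theta_i$ is a complex line bundle. *)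

(* Defs.v *)
From HB Require Import structures.
From mathcomp Require Import all_boot all_order all_algebra.
From mathcomp Require Import all_classical all_reals all_analysis.
From mathcomp.real_closed Require Import complex.

Set Implicit Arguments.
Unset Strict Implicit.
Unset Printing Implicit Defensive.

Import Order.TTheory GRing.Theory Num.Theory.
Import numFieldNormedType.Exports.

Local Open Scope classical_set_scope.
Local Open Scope ring_scope.
Local Open Scope quotient_scope.

(* [R[i]] itself carries no canonical topology; packaged as an abstract
   [numClosedFieldType] it gets the one induced by the complex modulus. *)
Definition Cplx (R : realType) : numClosedFieldType := R[i].

Definition homeomorphic (X Y : topologicalType) : Prop :=
  exists (f : X -> Y) (g : Y -> X),
    [/\ continuous f, continuous g, cancel f g & cancel g f].

Definition one_point : topologicalType := discrete_topology unit.

Section Collapse.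
Variables (X : topologicalType) (A : set X).

Definition collapse_rel (x y : X) : bool :=
  (x == y) || ((x \in A) && (y \in A)).

Lemma collapse_rel_refl : reflexive collapse_rel.
Proof. by move=> x; rewrite /collapse_rel eqxx. Qed.

Lemma collapse_rel_sym : symmetric collapse_rel.
Proof. by move=> x y; rewrite /collapse_rel eq_sym andbC. Qed.

Lemma collapse_rel_trans : transitive collapse_rel.
Proof.
move=> y x z /orP[/eqP-> //|/andP[xA yA]] /orP[/eqP<-|/andP[_ zA]].
  by rewrite /collapse_rel xA yA orbT.
by rewrite /collapse_rel xA zA orbT.
Qed.

Canonical collapse_equiv :=
  EquivRel collapse_rel collapse_rel_refl collapse_rel_sym collapse_rel_trans.

(* The quotient X / A.  When A is empty this is X, with no point added. *)
Definition collapse : topologicalType :=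
  quotient_topology {eq_quot collapse_equiv}.

End Collapse.

Section WeightedProjectiveSpace.
Variables (R : realType) (n : nat) (chi : 'I_n.+1 -> nat).
Local Notation C := (Cplx R).

Definition unit_sphere : set 'rV[C]_n.+1 :=
  [set z | \sum_(i < n.+1) `|z 0 i| ^+ 2 = 1].

Definition weighted_act (t : C) (z : 'rV[C]_n.+1) : 'rV[C]_n.+1 :=
  \row_i (t ^+ chi i * z 0 i).

Definition same_orbit (z w : unit_sphere) : bool :=
  `[< exists2 t : C, `|t| = 1 & weighted_act t (set_val z) = set_val w >].

Lemma same_orbit_refl : reflexive same_orbit.
Proof.
move=> z; apply/asboolP; exists 1; first by rewrite normr1.
by apply/rowP => i; rewrite mxE expr1n mul1r.
Qed.

Lemma same_orbit_sym : symmetric same_orbit.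
Proof.
suff H z w : same_orbit z w -> same_orbit w z.
  by move=> z w; apply/idP/idP; exact: H.
move=> /asboolP[t t1 tzw]; apply/asboolP; exists t^-1.
  by rewrite normfV t1 invr1.
have t0 : t != 0 by rewrite -normr_eq0 t1 oner_eq0.
by apply/rowP => i; rewrite -tzw !mxE mulrA -exprMn mulVf// expr1n mul1r.
Qed.

Lemma same_orbit_trans : transitive same_orbit.
Proof.
move=> w z v /asboolP[t t1 tzw] /asboolP[s s1 swv].
apply/asboolP; exists (s * t); first by rewrite normrM t1 s1 mulr1.
by apply/rowP => i; rewrite -swv -tzw !mxE exprMn mulrA.
Qed.

Canonical same_orbit_equiv :=
  EquivRel same_orbit same_orbit_refl same_orbit_sym same_orbit_trans.

Definition weighted_projective_space : topologicalType :=
  quotient_topology {eq_quot same_orbit_equiv}.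

End WeightedProjectiveSpace.

Arguments unit_sphere : clear implicits.

Definition weight_vector (n : nat) (chi : 'I_n.+1 -> nat) : Prop :=
  forall i, (0 < chi i)%N.

Definition divisive (n : nat) (chi : 'I_n.+1 -> nat) : Prop :=
  forall i j : 'I_n.+1, j = i.+1 :> nat -> (chi i %| chi j)%N.

Section LocalTriviality.
Variables (R : realType) (d : nat) (B E : topologicalType).
Local Notation C := (Cplx R).
Variables (proj : E -> B) (fiber : B -> lmodType C).
Variable incl : forall b, fiber b -> E.

(* (proj, phi) is a homeomorphism from the part of E over U onto U x C^d, with
   inverse psi, and is linear on each fibre. *)
Definition trivialization (U : set B) (phi : E -> 'rV[C]_d) : Prop :=
  [/\ {within proj @^-1` U, continuous phi},
      forall b, U b -> linear (phi \o @incl b) &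
      exists psi : B * 'rV[C]_d -> E,
        [/\ {within U `*` setT, continuous psi},
            forall b v, U b -> proj (psi (b, v)) = b,
            forall b v, U b -> phi (psi (b, v)) = v &
            forall e, U (proj e) -> psi (proj e, phi e) = e]].

End LocalTriviality.

(* The vector space over b is a library left module [vb_fiber b], identified with
   the point-set fibre [vb_proj @^-1` [set b]] of the total space by [vb_incl b]. *)
Record complex_vector_bundle (R : realType) (d : nat) (B : topologicalType) :=
  ComplexVectorBundle {
    vb_total : topologicalType;
    vb_proj : vb_total -> B;
    vb_fiber : B -> lmodType (Cplx R);
    vb_incl : forall b, vb_fiber b -> vb_total;
    vb_incl_inj : forall b, injective (@vb_incl b);
    vb_incl_range : forall b, range (@vb_incl b) = vb_proj @^-1` [set b];
    vb_proj_continuous : continuous vb_proj;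
    vb_locally_trivial : forall b, exists U (phi : vb_total -> 'rV[Cplx R]_d),
      [/\ open U, U b & trivialization vb_proj vb_incl U phi] }.

Arguments vb_incl {R d B} c {b}.

Definition complex_line_bundle (R : realType) (B : topologicalType) :=
  complex_vector_bundle R 1 B.

Section ThomSpace.
Variables (R : realType) (d : nat) (B : topologicalType).
Variable theta : complex_vector_bundle R d B.
Local Notation C := (Cplx R).
Local Notation E := (vb_total theta).

(* [hform u v] is only meaningful for u and v in the same fibre. *)
Record hermitian_metric := HermitianMetric {
  hform : E -> E -> C;
  hform_dot : forall b, exists h : {dot vb_fiber theta b for Num.conj},
    forall u v, hform (vb_incl theta u) (vb_incl theta v) = h u v;
  hform_continuous :
    {within [set uv : E * E | vb_proj uv.1 = vb_proj uv.2],
      continuous (fun uv : E * E => hform uv.1 uv.2)} }.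

Variable g : hermitian_metric.

Definition unit_disc_bundle : set E := [set e | hform g e e <= 1].

Definition unit_sphere_bundle : set unit_disc_bundle :=
  [set e | hform g (set_val e) (set_val e) = 1].

(* D(theta) / S(theta); S(theta) is nonempty as soon as 0 < d and B is. *)
Definition thom_space : topologicalType := collapse unit_sphere_bundle.

End ThomSpace.

(* The spaces X i with n < i are irrelevant.  The homeomorphism type of a Thom
   space is that of D / S for some Hermitian metric on the bundle. *)
Definition iterated_thom_space_of_line_bundles
    (R : realType) (n : nat) (X0 Y : topologicalType) : Prop :=
  exists X : nat -> topologicalType,
    [/\ X 0 = X0, X n = Y &
        forall i, (i < n)%N ->
          exists (theta : complex_line_bundle R (X i))
                 (g : hermitian_metric theta),
            homeomorphic (X i.+1) (thom_space g)].

(* Main.v *)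
(** Write P_m for the weighted projective space of the first m + 1 weights and
    k for the next weight.  All previous weights divide k, so the stabiliser in
    T of a point z of the sphere acts trivially on the representation t ^ k of T;
    hence L = (S x C) / T, with T acting on C through t ^ k, is a line bundle
    over P_m.  It is trivial where z_i <> 0: the coordinate u / z_i ^ (k / chi_i)
    of [z, u] is invariant.  The map
      [z, u] |-> [(1 - |u|^2) / (1 + |u|^2) z, 2 u / (1 + |u|^2)]
    from the unit disc bundle of L to P_(m+1) collapses exactly the unit sphere
    bundle, to the point [0, 1], and is onto; it induces a homeomorphism because
    the Thom space is compact and P_(m+1) is Hausdorff. *)
From HB Require Import structures.
Require Import Defs.
From mathcomp Require Import all_boot all_order all_algebra.
From mathcomp Require Import all_classical all_reals all_analysis.
From mathcomp.real_closed Require Import complex.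
From mathcomp Require Import ring.

Set Implicit Arguments.
Unset Strict Implicit.
Unset Printing Implicit Defensive.

Import Order.TTheory GRing.Theory Num.Theory.
Import numFieldNormedType.Exports.

Local Open Scope classical_set_scope.
Local Open Scope ring_scope.
Local Open Scope quotient_scope.

(** * Continuity on quotients and products *)

(** A product of quotient maps may fail to be a quotient map, whereas openness survives products.
    Continuity on [L * L] or on the product of [P] with a vector space can then be tested on
    representatives. *)
Definition open_map (X Y : topologicalType) (p : X -> Y) :=
  forall x (A : set X), nbhs x A -> nbhs (p x) (p @` A).

Lemma open_map_id (X : topologicalType) : open_map (@id X).
Proof. by move=> x A; rewrite image_id. Qed.

Lemma open_map_prod (X Y X' Y' : topologicalType) (p : X -> Y) (q : X' -> Y') :
  open_map p -> open_map q -> open_map (fun xy => (p xy.1, q xy.2)).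
Proof.
move=> op oq [x x'] A [[P Q] /= [xP xQ] PQA].
exists (p @` P, q @` Q) => /=; first by split; [exact: op|exact: oq].
by move=> [y y'] /= [[u Pu <-] [v Qv <-]]; exists (u, v) => //; exact: PQA.
Qed.

(** Images of neighbourhoods are neighbourhoods. The statement is pointwise so that it also serves
    functions continuous on only part of a quotient, such as the bundle charts. *)
Lemma open_map_cvg (X Y Z : topologicalType) (p : X -> Y) (f : Y -> Z) (x : X) :
  open_map p -> {for x, continuous (f \o p)} -> {for p x, continuous f}.
Proof.
move=> op fp W /fp /= /op; apply: filterS => _ [u Wu <-]; exact: Wu.
Qed.

Section QuotientByHomeomorphisms.
Variables (X : topologicalType) (e : equiv_rel X).
Local Notation Q := (quotient_topology {eq_quot e}).

Lemma pi_quotient_eqP (x y : X) : \pi_Q x = \pi_Q y <-> e x y.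
Proof. by split=> /(@eqmodP _ e). Qed.

(** The saturation of an open [U] is a neighbourhood of each of its points [y]: some continuous [a]
    moves [y] into [U] while preserving every class, and the preimage of [U] under [a] lies in the
    saturation. *)
Lemma pi_open_map :
  (forall x y, e x y -> exists a : X -> X,
    [/\ forall z, continuous_at z a, a x = y & forall z, e z (a z)]) ->
  open_map (\pi_Q : X -> Q).
Proof.
move=> act x A; rewrite nbhsE => -[U [oU Ux] UA].
apply: (@filterS _ _ _ (\pi_Q @` U)); first exact: image_subset.
apply: open_nbhs_nbhs; split; last by exists x.
rewrite /open /= /quotient_open openE => y [u Uu /pi_quotient_eqP].
rewrite (generic_quotient.equiv_sym e) => /act [a [ca ayu ea]].
have : nbhs y (a @^-1` U) by apply: ca; rewrite ayu; exact: open_nbhs_nbhs.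
by apply: filterS => z Uaz; exists (a z) => //;
  apply/pi_quotient_eqP; rewrite (generic_quotient.equiv_sym e).
Qed.

End QuotientByHomeomorphisms.

(** * Compact and Hausdorff spaces *)

Lemma compact_bij_homeomorphic (X Y : topologicalType) (f : X -> Y) :
  compact [set: X] -> hausdorff_space Y -> continuous f -> injective f ->
  (forall y, exists x, f x = y) -> homeomorphic X Y.
Proof.
move=> cX hY cf injf surjf; pose g y := sval (cid (surjf y)).
have gK : cancel g f by move=> y; exact: svalP (cid (surjf y)).
have fK : cancel f g by move=> x; apply: injf; rewrite gK.
exists f, g; split=> //; apply/continuous_closedP => A cA.
have -> : g @^-1` A = f @` A.
  by apply/seteqP; split=> [y Agy|_ [x Ax <-]]; [exists (g y)|rewrite /= fK].
apply: compact_closed => //.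
exact: continuous_compact (continuous_subspaceT cf)
  (subclosed_compact cA cX (@subsetT _ A)).
Qed.

Lemma compact_setT_image (X Y : topologicalType) (f : X -> Y) (A : set X) :
  compact A -> continuous f -> f @` A = setT -> compact [set: Y].
Proof.
move=> cA cf <-; exact: continuous_compact (continuous_subspaceT cf) cA.
Qed.

Lemma hausdorff_inj (X Y : topologicalType) (f : X -> Y) :
  hausdorff_space Y -> continuous f -> injective f -> hausdorff_space X.
Proof.
move=> hY cf injf p q pq; apply/injf/hY => A B /cf fpA /cf fqB.
by have [x [Ax Bx]] := pq _ _ fpA fqB; exists (f x).
Qed.

(** A filter on the subtype is pushed forward to [X]. Its cluster point in [A] lifts back, because
    neighbourhoods in the subtype are traces of open sets of [X]. *)
Lemma compact_set_type (X : topologicalType) (A : set X) :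
  compact A -> compact [set: A].
Proof.
move=> cA F FF _.
have FA : (set_val @ F) A.
  by apply: (@filterS _ F _ setT) filterT => -[x xA] _; exact: set_mem xA.
have [a [Aa Fa]] := cA _ (fmap_proper_filter set_val FF) FA.
exists (exist _ a (mem_set Aa)); split=> // B C FB [_ [[W oW <-] Wa WC]].
have FB' : (set_val @ F) (set_val @` B) 
  by apply: (@filterS _ F _ B) FB => x Bx; exists x.
have [_ [[x Bx <-] Wx]] := Fa _ W FB' (open_nbhs_nbhs (conj oW Wa)).
by exists x; split=> //; exact: WC.
Qed.

Lemma homeomorphic_sym (X Y : topologicalType) :
  homeomorphic X Y -> homeomorphic Y X.
Proof. by move=> [f [g [cf cg fK gK]]]; exists g, f. Qed.

(** * Rules for continuity at a point *)

Lemma eq_continuous_at (X Y : topologicalType) (f g : X -> Y) x :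
  f =1 g -> continuous_at x f -> continuous_at x g.
Proof. by move=> /funext ->. Qed.

Section ContinuousAtPair.
Variables (X Y Z : topologicalType) (x : X).

Lemma continuous_at_comp (f : X -> Y) (g : Y -> Z) :
  continuous_at x f -> continuous_at (f x) g ->
  continuous_at x (fun y => g (f y)).
Proof. exact: continuous_comp. Qed.

Lemma continuous_at_pair (f : X -> Y) (g : X -> Z) :
  continuous_at x f -> continuous_at x g ->
  continuous_at x (fun y => (f y, g y)).
Proof. by move=> fx gx; exact: cvg_pair. Qed.

End ContinuousAtPair.

Lemma continuous_at_id (X : topologicalType) (x : X) : continuous_at x id.
Proof. exact: cvg_id. Qed.

Lemma continuous_at_mx (X K : topologicalType) m n (f : X -> 'M[K]_(m, n)) x :
  (forall i j, continuous_at x (fun y => f y i j)) -> continuous_at x f.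
Proof.
move=> fl A [P lP PA].
have : \forall y \near x, forall i j, P i j (f y i j).
  by apply: filter_forall => i; apply: filter_forall => j; exact: fl.
by apply: filterS => y Py; exact: PA.
Qed.

Section ContinuousAt.
Variables (X : topologicalType) (K : numClosedFieldType) (x : X).
Implicit Types f g : X -> K.

Lemma continuous_at_cst (Y : topologicalType) (y : Y) :
  continuous_at x (fun=> y).
Proof. exact: cvg_cst. Qed.

Lemma continuous_atD f g : continuous_at x f -> continuous_at x g ->
  continuous_at x (fun y => f y + g y).
Proof. by move=> fx gx; exact: cvgD. Qed.

Lemma continuous_atB f g : continuous_at x f -> continuous_at x g ->
  continuous_at x (fun y => f y - g y).
Proof. by move=> fx gx; exact: cvgB. Qed.

Lemma continuous_atM f g : continuous_at x f -> continuous_at x g ->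
  continuous_at x (fun y => f y * g y).
Proof. by move=> fx gx; exact: cvgM. Qed.

Lemma continuous_atV f : f x != 0 -> continuous_at x f ->
  continuous_at x (fun y => (f y)^-1).
Proof. by move=> fx0 fx; exact: cvgV. Qed.

Lemma continuous_atX f n : continuous_at x f ->
  continuous_at x (fun y => f y ^+ n).
Proof.
move=> fx; elim: n => [|n IHn].
  by by apply: (@eq_continuous_at X K (fun=> 1)) => //; exact: continuous_at_cst.
apply: (@eq_continuous_at X K (fun y => f y * f y ^+ n)) => [y|].
  by rewrite exprS.
exact: continuous_atM.
Qed.

Lemma continuous_at_norm f : continuous_at x f ->
  continuous_at x (fun y => `|f y|).
Proof. by move=> fx; exact: cvg_norm. Qed.

Lemma continuous_at_sum (I : finType) (f : I -> X -> K) :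
  (forall i, continuous_at x (f i)) ->
  continuous_at x (fun y => \sum_i f i y).
Proof.
move=> fx; rewrite /continuous_at; apply: cvg_big => [y|i _]; last exact: fx.
by apply: cvgD; [exact: cvg_fst|exact: cvg_snd].
Qed.

End ContinuousAt.

Lemma continuous_at_conj (X : topologicalType) (K : numClosedFieldType) (x : X)
    (f : X -> K) : continuous_at x f -> continuous_at x (fun y => (f y)^* ).
Proof.
move=> /cvgrPdist_lt fx; apply/cvgrPdist_lt => eps e0.
by apply: filterS (fx _ e0) => y; rewrite -rmorphB norm_conjC.
Qed.

(** The disc is the image under (x, y) |-> x + iy of a closed subset of the compact square [[-1, 1]]
    x [[-1, 1]]. *)
Lemma compact_disc (R : realType) : compact [set z : Cplx R | `|z| <= 1].
Proof.
pose h (p : R * R) : Cplx R := (p.1%:C + 'i * p.2%:C)%C.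
have ch : continuous h.
  have cR : continuous (fun x : R => x%:C%C : Cplx R).
    (* The radius is a positive element of [R[i]]; positivity forces its imaginary part to vanish,
       leaving a real epsilon. *)
    move=> x; apply/cvgrPdist_lt => -[eps eps'] /[!ltcE]/= /andP[/eqP-> e0].
    near=> y; rewrite -rmorphB/= normc_def/= expr0n addr0 sqrtr_sqr ltcR.
    near: y; move: eps e0.
    by apply: (@cvgr_dist_lt _ R^o); exact: cvg_id.
  move=> p; apply: continuous_atD.
    by apply: continuous_comp; [exact: cvg_fst|exact: cR].
  apply: continuous_atM; first exact: continuous_at_cst.
  by apply: continuous_comp; [exact: cvg_snd|exact: cR].
have cI : compact (`[-1, 1]%classic `*` `[-1, 1]%classic : set (R * R)).
  by apply: compact_setX; exact: segment_compact.
pose D := [set p : R * R | p.1 ^+ 2 + p.2 ^+ 2 <= 1].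
have cD : closed D.
  apply: (@closed_comp _ _ (fun p : R * R => p.1 ^+ 2 + p.2 ^+ 2) [set y | y <= 1]).
    by move=> p _; apply: cvgD; apply: cvgM; (exact: cvg_fst || exact: cvg_snd).
  exact: closed_le.
have -> : [set z : Cplx R | `|z| <= 1] = h @` D.
  have hE (p : R * R) : (`|h p| <= 1) = (p.1 ^+ 2 + p.2 ^+ 2 <= 1).
    have -> : h p = (p.1 +i* p.2)%C by apply/eqP; rewrite eq_complex /=; simpc.
    by rewrite normc_def/= -[1]/(1%:C)%C lecR -{1}sqrtr1 ler_sqrt.
  apply/seteqP; split=> [z z1|_ [p Dp <-]]; last by rewrite /= hE.
  have zE : h (complex.Re z, complex.Im z) = z.
    by rewrite /h /= [RHS]complexE.
  exists (complex.Re z, complex.Im z); last exact: zE.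
  by move: z1; rewrite /= -{1}zE hE.
apply: (continuous_compact (continuous_subspaceT ch)).
apply: (subclosed_compact cD cI) => -[x y]; rewrite /D/= => xy1.
have sq1 (a b : R) : a ^+ 2 + b ^+ 2 <= 1 -> a \in `[-1, 1].
  move=> ab; rewrite in_itv /= -ler_norml -(ler_sqr (normr_nneg a))// ?nnegrE//.
  rewrite expr1n real_normK ?num_real//.
  by apply: le_trans ab; rewrite lerDl sqr_ge0.
by split; [exact: sq1 xy1|apply: (sq1 y x); rewrite addrC].
Unshelve. all: by end_near. Qed.

(** * Divisive weighted projective spaces *)

Lemma unit_root (C : numClosedFieldType) k (s : C) : (0 < k)%N -> `|s| = 1 ->
  exists2 t : C, `|t| = 1 & t ^+ k = s.
Proof.
move=> k0 s1; exists (k.-root s); last exact: rootCK.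
by apply/eqP; rewrite -(@pexpr_eq1 _ _ k)// -normrX rootCK// s1.
Qed.

Lemma unit_neq0 (C : numClosedFieldType) (t : C) : `|t| = 1 -> t != 0.
Proof. by move=> t1; rewrite -normr_eq0 t1 oner_eq0. Qed.

Lemma unit_conjX (C : numClosedFieldType) (t : C) k : `|t| = 1 ->
  t ^+ k * (t ^+ k)^* = 1.
Proof. by move=> t1; rewrite -normCK normrX t1 !expr1n. Qed.

Lemma divisive_dvdn n (chi : 'I_n.+1 -> nat) (i j : 'I_n.+1) :
  divisive chi -> (i <= j)%N -> (chi i %| chi j)%N.
Proof.
move=> div; case: j => j jn /=; elim: j jn => [|j IHj] jn.
  by rewrite leqn0 => /eqP i0; rewrite (_ : Ordinal jn = i)//; exact/val_inj.
rewrite leq_eqVlt => /predU1P[ij|].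
  by rewrite (_ : Ordinal jn = i)//; exact/val_inj.
rewrite ltnS => /(IHj (ltnW jn)) /dvdn_trans; apply; exact: div.
Qed.

Section WeightedProjectiveSpaces.
Variables (R : realType) (n : nat).
Local Notation C := (Cplx R).
Local Notation S := (unit_sphere R n).

Lemma sphere_neq0 (z : S) : exists i, set_val z 0 i != 0.
Proof.
apply/existsP; rewrite -negb_forall; apply/negP => /forallP z0.
have := set_valP z; rewrite /unit_sphere /= big1 => [/esym/eqP|i _].
  by rewrite oner_eq0.
by rewrite (eqP (z0 i)) normr0 expr0n.
Qed.

Definition in_sphere (z : 'rV[C]_n.+1) (Sz : unit_sphere R n z) : S :=
  exist _ z (mem_set Sz).

Lemma in_sphereE z (Sz : unit_sphere R n z) : set_val (in_sphere Sz) = z.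
Proof. by []. Qed.

Lemma sphere_coord_continuous i : continuous (fun z : S => set_val z 0 i).
Proof.
move=> z; apply: (@continuous_comp S _ _ set_val (fun M : 'rV[C]_n.+1 => M 0 i)).
  exact: initial_continuous.
exact: coord_continuous.
Qed.

Lemma sphere_continuous (X : topologicalType) (f : X -> S) :
  (forall i x, continuous_at x (fun y => set_val (f y) 0 i)) -> continuous f.
Proof.
move=> cf; apply: (@continuous_comp_initial _ _ _ set_val f) => x.
by apply: continuous_at_mx => i j; rewrite ord1; exact: cf.
Qed.

Lemma compact_sphere : compact [set: S].
Proof.
apply: compact_set_type.
apply: (subclosed_compact _ (@rV_compact C n.+1 (fun=> [set z | `|z| <= 1]) _)).
- apply: (@closed_comp _ _ (fun z : 'rV[C]_n.+1 => \sum_i `|z 0 i| ^+ 2) [set 1]).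
    move=> z _; apply: continuous_at_sum => i; apply: continuous_atX.
    apply: continuous_at_norm.
    exact: coord_continuous.
  apply: accessible_closed_set1; apply: hausdorff_accessible.
  exact: norm_hausdorff.
- by move=> _; exact: compact_disc.
- move=> z; rewrite /unit_sphere/= => z1 i.
  by rewrite -(@expr_le1 _ 2)// -z1 (bigD1 i)//= lerDl sumr_ge0.
Qed.

Variable chi : 'I_n.+1 -> nat.
Local Notation act := (weighted_act chi).
Local Notation P := (weighted_projective_space R chi).
Local Notation piP := (\pi_P : S -> P).

Lemma act_sphere (t : C) z :
  `|t| = 1 -> unit_sphere R n z -> unit_sphere R n (act t z).
Proof.
move=> t1; rewrite /unit_sphere /= => <-; apply: eq_bigr => i _.
by rewrite mxE normrM normrX t1 expr1n mul1r.
Qed.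

Definition sphere_act t (t1 : `|t| = 1) (z : S) : S :=
  in_sphere (act_sphere t1 (set_valP z)).

Lemma sphere_actE t (t1 : `|t| = 1) (z : S) :
  set_val (sphere_act t1 z) = act t (set_val z).
Proof. by []. Qed.

Lemma sphere_act_continuous t (t1 : `|t| = 1) : continuous (sphere_act t1).
Proof.
apply: sphere_continuous => i z.
apply: (@eq_continuous_at S C (fun y => t ^+ chi i * set_val y 0 i)) => [y|].
  by rewrite sphere_actE mxE.
apply: continuous_atM; first exact: continuous_at_cst.
exact: sphere_coord_continuous.
Qed.

Lemma piP_eqP (z w : S) : piP z = piP w <->
  exists2 t : C, `|t| = 1 & act t (set_val z) = set_val w.
Proof.
split=> [/pi_quotient_eqP/asboolP//|zw].
by apply/pi_quotient_eqP/asboolP.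
Qed.

Lemma piP_open_map : open_map piP.
Proof.
apply: pi_open_map => z w /asboolP[t t1 tz]; exists (sphere_act t1); split.
- exact: sphere_act_continuous.
- exact/val_inj.
- by move=> v; apply/asboolP; exists t.
Qed.

Lemma piP_continuous : continuous piP. Proof. exact: pi_continuous. Qed.

Lemma piPK (x : P) : exists z, piP z = x.
Proof. by exists (repr x); exact: reprK. Qed.

(* With weights [chi i %| chi j] the functions
   [z_i ^ (chi j / chi i) * conj z_j] are invariant, and they recover the orbit:
   normalise the first nonzero coordinate, which determines all later ones. *)
Definition invariants (z : S) : 'M[C]_n.+1 :=
  \matrix_(i, j) if (i <= j)%N
    then set_val z 0 i ^+ (chi j %/ chi i) * (set_val z 0 j)^* else 0.

Lemma invariants_continuous : continuous invariants.
Proof.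
move=> z; apply: continuous_at_mx => i j.
apply: (@eq_continuous_at S C (fun y => if (i <= j)%N then
    set_val y 0 i ^+ (chi j %/ chi i) * (set_val y 0 j)^* else 0)) => [y|].
  by rewrite mxE.
case: (i <= j)%N; last exact: continuous_at_cst.
apply: continuous_atM; [apply: continuous_atX|apply: continuous_at_conj];
  exact: sphere_coord_continuous.
Qed.

Hypotheses (chi_pos : weight_vector chi) (chi_div : divisive chi).

Lemma invariantsP (z w : S) : invariants z = invariants w <-> piP z = piP w.
Proof.
rewrite piP_eqP; split=> [zw|[t t1 zw]]; last first.
  apply/matrixP => i j; rewrite !mxE; case: ifP => // ij.
  rewrite -zw !mxE exprMn -exprM mulnC divnK; last exact: divisive_dvdn.
  by rewrite rmorphM/= mulrACA unit_conjX// mul1r.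
have zwE (i j : 'I_n.+1) : (i <= j)%N ->
    set_val z 0 i ^+ (chi j %/ chi i) * (set_val z 0 j)^* =
    set_val w 0 i ^+ (chi j %/ chi i) * (set_val w 0 j)^*.
  by move=> ij; move/matrixP : zw => /(_ i j); rewrite !mxE ij.
(* The diagonal invariants, with exponent 1, are the squared moduli of the coordinates. *)
have normE i : `|set_val z 0 i| = `|set_val w 0 i|.
  apply/eqP; rewrite -(@eqrXn2 _ 2)//; have := zwE i i (leqnn i).
  by rewrite divnn chi_pos !expr1 -!normCK => ->.
have [i0 zi0 i0_min] : exists2 i0, set_val z 0 i0 != 0 &
    forall i, set_val z 0 i != 0 -> (i0 <= i)%N.
  have [i1 zi1] := sphere_neq0 z.
  by case: (@arg_minnP _ i1 (fun i => set_val z 0 i != 0) val zi1) => i0; exists i0.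
(* [t] is forced up to a root of unity: it must carry the first nonzero coordinate of [z] to that of
   [w]. It can be taken unimodular because the moduli agree. *)
have [t t1 tE] : exists2 t : C, `|t| = 1 &
    t ^+ chi i0 = set_val w 0 i0 / set_val z 0 i0.
  apply: (unit_root (chi_pos i0)).
  by rewrite normf_div -normE divff// normr_eq0.
exists t => //; apply/rowP => j; rewrite mxE.
have [zj0|zj0] := eqVneq (set_val z 0 j) 0.
  by rewrite zj0 mulr0; apply/esym/normr0_eq0; rewrite -normE zj0 normr0.
have ij := i0_min _ zj0.
have tjE : t ^+ chi j * set_val z 0 i0 ^+ (chi j %/ chi i0) =
    set_val w 0 i0 ^+ (chi j %/ chi i0).
  rewrite -{1}(divnK (divisive_dvdn chi_div ij)) mulnC exprM tE -exprMn.
  by rewrite divfK.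
(* Later coordinates occur conjugated in the invariants, so the goal is conjugated and multiplied by
   the nonzero power of coordinate [i0]. *)
apply: (fmorph_inj (@Num.conj C)).
have z00 : set_val z 0 i0 ^+ (chi j %/ chi i0) != 0 by rewrite expf_neq0.
apply: (mulfI z00); rewrite rmorphM/= mulrCA zwE// -tjE.
by rewrite mulrA mulrA [_^* * _]mulrC unit_conjX// mul1r.
Qed.

(** The invariants descend to a continuous injection of the orbit space into a Hausdorff space of
    matrices. *)
Lemma weighted_projective_space_hausdorff : hausdorff_space P.
Proof.
have invE z : invariants (repr (piP z)) = invariants z.
  by apply/invariantsP; exact: reprK.
refine (@hausdorff_inj P 'M[C]_n.+1 (fun x : P => invariants (repr x)) _ _ _).
- exact: norm_hausdorff.
- apply/quotient_continuous => z.
  apply: (@eq_continuous_at S 'M[C]_n.+1 invariants) => [y|].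
    by rewrite /= invE.
  exact: invariants_continuous.
- by move=> x y /= /invariantsP; rewrite !reprK.
Qed.

End WeightedProjectiveSpaces.

(** * The line bundle of a character *)

(** The model metric on a fibre; the instances below make it the dot product that [hform_dot] asks
    for. *)
Definition conj_form (K : numClosedFieldType) (u v : K^o) : K := u * v^*.

Section ConjForm.
Variable K : numClosedFieldType.
Local Notation form := (@conj_form K).

Lemma conj_form_bilinear :
  bilinear_for ( *%R : GRing.Scale.law _ _)
    (Num.conj \; *%R : GRing.Scale.law _ _) form.
Proof.
split=> [v|u] a x y; rewrite /conj_form /=.
  by rewrite mulrDl -mulrA.
by rewrite rmorphD rmorphM mulrDr mulrCA.
Qed.

Lemma conj_form_hermitian (u v : K^o) : form u v = (-1) ^+ false * (form v u)^*.
Proof. by rewrite /conj_form expr0 mul1r rmorphM/= conjCK mulrC. Qed.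

Lemma conj_form_gt0 (u : K^o) : u != 0 -> 0 < form u u.
Proof. by move=> u0; rewrite /conj_form -normCK exprn_gt0// normr_gt0. Qed.

HB.instance Definition _ := bilinear_isBilinear.Build K K^o K^o K
  ( *%R ) (Num.conj \; *%R ) form conj_form_bilinear.
HB.instance Definition _ := isHermitianSesquilinear.Build K K^o false
  Num.conj form conj_form_hermitian.
HB.instance Definition _ := isDotProduct.Build K K^o form conj_form_gt0.

End ConjForm.

Section LineBundle.
Variables (R : realType) (n : nat) (chi : 'I_n.+1 -> nat) (k : nat).
Local Notation C := (Cplx R).
Local Notation S := (unit_sphere R n).
Local Notation act := (weighted_act chi).
Local Notation P := (weighted_projective_space R chi).
Local Notation piP := (\pi_P : S -> P).

Definition same_line (p q : S * C) : bool :=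
  `[< exists2 t : C, `|t| = 1 &
      act t (set_val p.1) = set_val q.1 /\ t ^+ k * p.2 = q.2 >].

Lemma same_line_refl : reflexive same_line.
Proof.
move=> p; apply/asboolP; exists 1; first exact: normr1.
split; last by rewrite expr1n mul1r.
by apply/rowP => i; rewrite mxE expr1n mul1r.
Qed.

Lemma same_line_sym : symmetric same_line.
Proof.
suff H p q : same_line p q -> same_line q p by move=> p q; apply/idP/idP; exact: H.
move=> /asboolP[t t1 [tp tq]]; apply/asboolP; exists t^-1.
  by rewrite normfV t1 invr1.
have t0 := unit_neq0 t1; split; last first.
  by rewrite -tq mulrA -exprMn mulVf// expr1n mul1r.
by apply/rowP => i; rewrite -tp !mxE mulrA -exprMn mulVf// expr1n mul1r.
Qed.

Lemma same_line_trans : transitive same_line.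
Proof.
move=> q p r /asboolP[t t1 [tp tq]] /asboolP[s s1 [sq sr]].
apply/asboolP; exists (s * t); first by rewrite normrM t1 s1 mulr1.
split; last by rewrite -sr -tq exprMn mulrA.
by apply/rowP => i; rewrite -sq -tp !mxE exprMn mulrA.
Qed.

Canonical same_line_equiv :=
  EquivRel same_line same_line_refl same_line_sym same_line_trans.

Definition line_total : topologicalType :=
  quotient_topology {eq_quot same_line_equiv}.
Local Notation L := line_total.
Local Notation piL := (\pi_L : (S * C)%type -> L).

Lemma piL_eqP (p q : S * C) : piL p = piL q <->
  exists2 t : C, `|t| = 1 &
    act t (set_val p.1) = set_val q.1 /\ t ^+ k * p.2 = q.2.
Proof.
split=> [/pi_quotient_eqP/asboolP//|pq].
by apply/pi_quotient_eqP/asboolP.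
Qed.

Lemma piL_continuous : continuous piL. Proof. exact: pi_continuous. Qed.

Lemma piL_open_map : open_map piL.
Proof.
apply: pi_open_map => -[z u] [w v] /asboolP[t t1 /= [tz tu]].
exists (fun p => (sphere_act chi t1 p.1, t ^+ k * p.2)); split.
- move=> p; apply: continuous_at_pair.
    apply: (@continuous_at_comp _ _ _ _ fst (sphere_act chi t1)).
      exact: cvg_fst.
    exact: sphere_act_continuous.
  by apply: continuous_atM; [exact: continuous_at_cst|exact: cvg_snd].
- by congr pair => //; exact: val_inj.
- by move=> p; apply/asboolP; exists t.
Qed.

(** Functions on [L] are defined through the representative chosen by [repr]. Invariance under T
    lets any representative be used instead. *)
Lemma line_descend (Y : Type) (f : S * C -> Y) :
  (forall t (t1 : `|t| = 1) z u, f (sphere_act chi t1 z, t ^+ k * u) = f (z, u)) ->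
  forall p, f (repr (piL p)) = f p.
Proof.
move=> finv p; have /piL_eqP[t t1 [tz tu]] : piL p = piL (repr (piL p)).
  by rewrite reprK.
case: p tz tu => z u; case: (repr _) => w v /= tz <-.
by rewrite -[RHS](finv t t1); congr (f (_, _)); apply: val_inj.
Qed.

Lemma line_continuous (Y : topologicalType) (f : S * C -> Y) (g : L -> Y) :
  (forall p, g (piL p) = f p) -> continuous f -> continuous g.
Proof.
move=> gf cf; apply/quotient_continuous.
by rewrite (_ : _ \o _ = f)//; apply/funext.
Qed.

(** * Coordinate powers and the Hermitian metric *)

Hypotheses (chi_pos : weight_vector chi) (k_gt0 : (0 < k)%N).
Hypothesis chi_k : forall i, (chi i %| k)%N.

(** This power transforms by the character t^k, exactly like the fibre coordinate, so the ratio of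
    the two is invariant. *)
Definition coord_pow (z : S) i : C := set_val z 0 i ^+ (k %/ chi i).

Lemma coord_pow_act t (t1 : `|t| = 1) z i :
  coord_pow (sphere_act chi t1 z) i = t ^+ k * coord_pow z i.
Proof.
by rewrite /coord_pow sphere_actE mxE exprMn -exprM mulnC divnK.
Qed.

Lemma coord_pow_continuous i : continuous (coord_pow^~ i).
Proof. by move=> z; apply: continuous_atX; exact: sphere_coord_continuous. Qed.

Lemma coord_pow_eq0 z i : (coord_pow z i == 0) = (set_val z 0 i == 0).
Proof.
rewrite /coord_pow expf_eq0 divn_gt0; last exact: chi_pos.
by rewrite (dvdn_leq k_gt0 (chi_k i)).
Qed.

(** Moving an argument along its orbit multiplies this Hermitian product by t^k or its conjugate.
    Ratios of such products offset the same factors coming from fibre coordinates. *)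
Definition coord_pow_dot (z w : S) : C := \sum_i coord_pow z i * (coord_pow w i)^*.

Lemma coord_pow_dot_gt0 z : 0 < coord_pow_dot z z.
Proof.
have [i zi] := sphere_neq0 z.
rewrite /coord_pow_dot (bigD1 i)//=; apply: ltr_pwDl.
  by rewrite -normCK exprn_gt0// normr_gt0 coord_pow_eq0.
by apply: sumr_ge0 => j _; rewrite -normCK exprn_ge0.
Qed.

Lemma coord_pow_dot_actl t (t1 : `|t| = 1) z w :
  coord_pow_dot (sphere_act chi t1 z) w = t ^+ k * coord_pow_dot z w.
Proof.
by rewrite mulr_sumr; apply: eq_bigr => i _; rewrite coord_pow_act mulrA.
Qed.

Lemma coord_pow_dot_actr t (t1 : `|t| = 1) z w :
  coord_pow_dot z (sphere_act chi t1 w) = (t ^+ k)^* * coord_pow_dot z w.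
Proof.
rewrite mulr_sumr; apply: eq_bigr => i _.
by rewrite coord_pow_act rmorphM/= mulrCA.
Qed.

Lemma coord_pow_dot_continuous :
  continuous (fun zw : S * S => coord_pow_dot zw.1 zw.2).
Proof.
move=> zw; apply: continuous_at_sum => i; apply: continuous_atM.
  apply: (@continuous_comp _ _ _ fst (coord_pow^~ i)); first exact: cvg_fst.
  exact: coord_pow_continuous.
apply: continuous_at_conj.
apply: (@continuous_comp _ _ _ snd (coord_pow^~ i)); first exact: cvg_snd.
exact: coord_pow_continuous.
Qed.

(* On a single fibre this is [u * conj v]; the quotient compensates for the
   choice of the two representatives. *)
Definition line_form_rep (p q : S * C) : C :=
  p.2 * q.2^* * coord_pow_dot q.1 p.1 / coord_pow_dot p.1 p.1.

Definition line_form (e e' : L) : C := line_form_rep (repr e) (repr e').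

(** The arguments are replaced one at a time. Each replacement brings factors t^k only paired with
    their conjugates, and each such pair equals 1. *)
Lemma line_formE p q : line_form (piL p) (piL q) = line_form_rep p q.
Proof.
rewrite /line_form (line_descend (f := line_form_rep ^~ _)) => [|t t1 z u].
  rewrite (line_descend (f := line_form_rep p)) // => t t1 z u.
  rewrite /line_form_rep /= coord_pow_dot_actl rmorphM /=.
  have := unit_conjX k t1; set a := t ^+ k; set b := _^* => ab.
  transitivity (a * b * (p.2 * u^* * coord_pow_dot z p.1 / coord_pow_dot p.1 p.1)).
    ring.
  by rewrite ab mul1r.
rewrite /line_form_rep /= coord_pow_dot_actl !coord_pow_dot_actr.
have := unit_conjX k t1; set a := t ^+ k; set b := _^* => ab.
rewrite (mulrA a b) ab mul1r.
transitivity (a * b * (u * (repr (piL q)).2^* * coord_pow_dot (repr (piL q)).1 z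
  / coord_pow_dot z z)); first by ring.
by rewrite ab mul1r.
Qed.

Lemma line_form_continuous :
  continuous (fun ee : L * L => line_form ee.1 ee.2).
Proof.
move=> [e e']; rewrite -[e]reprK -[e']reprK.
move: (repr e) (repr e') => p q {e e'}.
apply: (@open_map_cvg _ _ _ (fun pq : (S * C) * (S * C) => (piL pq.1, piL pq.2))
  (fun ee : L * L => line_form ee.1 ee.2) (p, q)).
  exact: open_map_prod piL_open_map piL_open_map.
apply: (@eq_continuous_at ((S * C) * (S * C))%type C
  (fun pq => line_form_rep pq.1 pq.2)) => [pq|]; first by rewrite /= line_formE.
have c1 : continuous_at (p, q) (fun pq : (S * C) * (S * C) => pq.1).
  exact: cvg_fst.
have c2 : continuous_at (p, q) (fun pq : (S * C) * (S * C) => pq.2).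
  exact: cvg_snd.
have cdot (f g : (S * C) * (S * C) -> S) :
    continuous_at (p, q) f -> continuous_at (p, q) g ->
    continuous_at (p, q) (fun pq => coord_pow_dot (f pq) (g pq)).
  move=> cf cg; apply: (@continuous_comp _ _ _ (fun pq => (f pq, g pq))
    (fun zw : S * S => coord_pow_dot zw.1 zw.2)).
    exact: continuous_at_pair.
  exact: coord_pow_dot_continuous.
have c11 : continuous_at (p, q) (fun pq : (S * C) * (S * C) => pq.1.1).
  by apply: (@continuous_comp _ _ _ fst fst); [exact: c1|exact: cvg_fst].
have c21 : continuous_at (p, q) (fun pq : (S * C) * (S * C) => pq.2.1).
  by apply: (@continuous_comp _ _ _ snd fst); [exact: c2|exact: cvg_fst].
apply: continuous_atM; [apply: continuous_atM; [apply: continuous_atM|]|].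
- by apply: (@continuous_comp _ _ _ fst snd); [exact: c1|exact: cvg_snd].
- apply: continuous_at_conj.
  by apply: (@continuous_comp _ _ _ snd snd); [exact: c2|exact: cvg_snd].
- exact: cdot.
- apply: continuous_atV; last exact: cdot.
  by rewrite gt_eqF// coord_pow_dot_gt0.
Qed.

(** * Bundle structure over a copy of the base *)

Section Bundle.
Variables (B : topologicalType) (h : B -> P) (h' : P -> B).
Hypotheses (ch : continuous h) (ch' : continuous h').
Hypotheses (hK : cancel h h') (h'K : cancel h' h).

(** The base is an arbitrary space [B] homeomorphic to [P], since the tower starts at the one-point
    space itself, which is only homeomorphic to P_0. *)
Definition line_proj (e : L) : B := h' (piP (repr e).1).

Definition line_fiber (b : B) : lmodType C := C^o.

Definition line_incl (b : B) (u : line_fiber b) : L := piL (repr (h b), u).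

Lemma line_projE p : line_proj (piL p) = h' (piP p.1).
Proof.
rewrite /line_proj (line_descend (f := fun p => h' (piP p.1)))// => t t1 z u.
by congr h'; apply/esym/piP_eqP; exists t.
Qed.

Lemma line_proj_continuous : continuous line_proj.
Proof.
apply: line_continuous line_projE _ => p.
apply: (@continuous_comp _ _ _ (fun p : S * C => piP p.1) h'); last exact: ch'.
apply: (@continuous_comp _ _ _ fst piP); first exact: cvg_fst.
exact: piP_continuous.
Qed.

(** Here the stabiliser acts trivially: if [t] fixes a point with z_i nonzero, then t^(chi_i) = 1,
    hence t^k = 1 as chi_i divides k. *)
Lemma line_incl_inj b : injective (@line_incl b).
Proof.
move=> u v /piL_eqP[t t1 /= [tz tu]].
have [i zi] := sphere_neq0 (repr (h b)).
have tk1 : t ^+ k = 1.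
  rewrite -(divnK (chi_k i)) mulnC exprM.
  suff -> : t ^+ chi i = 1 by rewrite expr1n.
  apply: (mulIf zi); rewrite mul1r.
  by move/rowP : tz => /(_ i); rewrite mxE.
by rewrite -tu tk1 mul1r.
Qed.

Lemma line_incl_range b : range (@line_incl b) = line_proj @^-1` [set b].
Proof.
apply/seteqP; split=> [_ [u _ <-]|e /= eb].
  by rewrite /= line_projE /= (reprK (h b)).
have : piP (repr e).1 = piP (repr (h b)).
  by rewrite reprK -eb /line_proj h'K.
move=> /piP_eqP[t t1 tz]; exists (t ^+ k * (repr e).2) => //.
rewrite -[RHS]reprK; apply/esym/piL_eqP; exists t => //.
Qed.

Definition line_chart i (e : L) : 'rV[C]_1 :=
  const_mx ((repr e).2 / coord_pow (repr e).1 i).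

Lemma line_chartE i p : line_chart i (piL p) = const_mx (p.2 / coord_pow p.1 i).
Proof.
rewrite /line_chart.
rewrite (line_descend (f := fun p => const_mx (p.2 / coord_pow p.1 i)))//.
move=> t t1 z u /=; rewrite coord_pow_act invfM mulrACA divff ?mul1r//.
by rewrite expf_neq0// unit_neq0.
Qed.

Definition line_chart_inv i (bv : B * 'rV[C]_1) : L :=
  piL (repr (h bv.1), bv.2 0 0 * coord_pow (repr (h bv.1)) i).

(** The section [repr] need not be continuous. The map is therefore lifted to the sphere along the
    open map [piP] x id, where its formula no longer involves [repr]. *)
Lemma line_chart_inv_continuous i : continuous (line_chart_inv i).
Proof.
pose psi (xv : P * 'rV[C]_1) : L := 
  piL (repr xv.1, xv.2 0 0 * coord_pow (repr xv.1) i).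
move=> bv; apply: (@continuous_comp _ _ _
  (fun bv : B * 'rV[C]_1 => (h bv.1, bv.2)) psi).
  apply: continuous_at_pair; last exact: cvg_snd.
  by apply: (@continuous_comp _ _ _ fst h); [exact: cvg_fst|exact: ch].
case: bv => b v /=; rewrite -[h b]reprK; move: (repr (h b)) => z {b}.
apply: (@open_map_cvg _ _ _ (fun zv : S * 'rV[C]_1 => (piP zv.1, zv.2)) psi (z, v)).
  exact: open_map_prod (@piP_open_map _ _ _) (@open_map_id _).
apply: (@eq_continuous_at (S * 'rV[C]_1)%type L
  (fun zv => piL (zv.1, zv.2 0 0 * coord_pow zv.1 i))) => [[w v']|].
  rewrite /= /psi /=; have /piP_eqP[t t1 tw] : piP w = piP (repr (piP w)).
    by rewrite reprK.
  apply/piL_eqP; exists t => //=; split => //.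
  have -> : repr (piP w) = sphere_act chi t1 w by exact/val_inj.
  by rewrite coord_pow_act mulrCA.
apply: (@continuous_comp _ _ _
  (fun zv : S * 'rV[C]_1 => (zv.1, zv.2 0 0 * coord_pow zv.1 i)) piL); last first.
  exact: piL_continuous.
apply: continuous_at_pair; first exact: cvg_fst.
apply: continuous_atM.
  apply: (@continuous_comp _ _ _ snd (fun v : 'rV[C]_1 => v 0 0)).
    exact: cvg_snd.
  exact: coord_continuous.
apply: (@continuous_comp _ _ _ fst (coord_pow^~ i)); first exact: cvg_fst.
exact: coord_pow_continuous.
Qed.

Lemma repr_neq0 i z : (set_val (repr (piP z)) 0 i != 0) = (set_val z 0 i != 0).
Proof.
have /piP_eqP[t t1 /rowP/(_ i)] : piP z = piP (repr (piP z)) by rewrite reprK.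
rewrite mxE => <-; rewrite mulf_eq0 expf_eq0.
by rewrite (negbTE (unit_neq0 t1)) andbF.
Qed.

Lemma line_locally_trivial b : exists U (phi : L -> 'rV[C]_1),
  [/\ open U, U b & trivialization line_proj line_incl U phi].
Proof.
have [i zi] := sphere_neq0 (repr (h b)).
(* Whether coordinate [i] vanishes is the same for all representatives, so [V] pulls back to the
   open set z_i <> 0 of the sphere. *)
pose V : set P := [set x : P | set_val (repr x : S) 0 i != 0].
have oV : open V.
  rewrite /open /= /quotient_open.
  rewrite (_ : _ @^-1` _ = [set z : S | set_val z 0 i != 0]); last first.
    by apply/seteqP; split=> z; rewrite /= /V /= repr_neq0.
  rewrite openE => z /= zi0.
  have : continuous_at z (fun z : S => set_val z 0 i).
    exact: sphere_coord_continuous.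
  move=> /cvgr_neq0; exact.
have oU : open (h @^-1` V) by move/continuousP: ch; apply.
exists (h @^-1` V), (line_chart i); split => //; split.
- have oU' : open (line_proj @^-1` (h @^-1` V)).
    by move/continuousP: line_proj_continuous; apply.
  rewrite continuous_open_subspace// => e; rewrite inE /= -[e]reprK.
  move: (repr e) => p {e}; rewrite line_projE h'K /V /= repr_neq0 => pi.
  apply: (open_map_cvg piL_open_map).
  apply: (@eq_continuous_at (S * C)%type 'rV[C]_1
    (fun p => const_mx (p.2 / coord_pow p.1 i))) => [q|].
    by rewrite /= line_chartE.
  apply: continuous_at_mx => ? ?.
  apply: (@eq_continuous_at (S * C)%type C (fun p => p.2 / coord_pow p.1 i)) => [q|].
    by rewrite mxE.
  apply: continuous_atM; first exact: cvg_snd.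
  apply: continuous_atV; first by rewrite coord_pow_eq0.
  apply: (@continuous_comp _ _ _ fst (coord_pow^~ i)); first exact: cvg_fst.
  exact: coord_pow_continuous.
- move=> c _ a u v /=; rewrite !line_chartE /=; apply/matrixP => ? ?.
  by rewrite !mxE mulrDl mulrA.
- exists (line_chart_inv i); split.
  + exact/continuous_subspaceT/line_chart_inv_continuous.
  + by move=> c v _; rewrite /line_chart_inv line_projE /= (reprK (h c)).
  + move=> c v Vc; rewrite /line_chart_inv line_chartE /= mulfK ?coord_pow_eq0//.
    by apply/matrixP => ? ?; rewrite mxE !ord1.
  + move=> e; rewrite -[e]reprK; move: (repr e) => p {e}.
    rewrite line_projE line_chartE /line_chart_inv /= h'K mxE /V /= => pi.
    have /piP_eqP[t t1 tw] : piP p.1 = piP (repr (piP p.1)) by rewrite reprK.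
    apply/esym/piL_eqP; exists t => //=; split => //.
    have -> : repr (piP p.1) = sphere_act chi t1 p.1 by exact/val_inj.
    by rewrite coord_pow_act mulrCA divfK// coord_pow_eq0 -repr_neq0.
Qed.

Definition associated_line_bundle : complex_line_bundle R B :=
  ComplexVectorBundle line_incl_inj line_incl_range line_proj_continuous
    line_locally_trivial.
Local Notation theta := associated_line_bundle.

(** Both vectors sit over the same representative, so the two products of coordinate powers
    cancel. *)
Lemma line_form_incl b (u v : line_fiber b) :
  line_form (line_incl u) (line_incl v) = @conj_form C u v.
Proof.
by rewrite line_formE /line_form_rep /= mulfK// gt_eqF// coord_pow_dot_gt0.
Qed.

Lemma line_form_dot b : exists f : {dot vb_fiber theta b for Num.conj},
  forall u v, line_form (vb_incl theta u) (vb_incl theta v) = f u v.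
Proof.
exists (@conj_form C : {dot C^o for Num.conj}) => u v; exact: line_form_incl.
Qed.

Definition line_metric : hermitian_metric theta :=
  @HermitianMetric R 1 B theta line_form line_form_dot
    (continuous_subspaceT line_form_continuous).

End Bundle.
End LineBundle.

(** * The Thom space *)

Section ThomSpaceOfLineBundle.
Variables (R : realType) (n : nat) (chi' : 'I_n.+2 -> nat).
Hypotheses (chi'_pos : weight_vector chi') (chi'_div : divisive chi').
Local Notation C := (Cplx R).
Local Notation S := (unit_sphere R n).
Local Notation S' := (unit_sphere R n.+1).
Local Notation chi := (fun i : 'I_n.+1 => chi' (lift ord_max i)).
Local Notation k := (chi' ord_max).
Local Notation P := (weighted_projective_space R chi).
Local Notation P' := (weighted_projective_space R chi').
Local Notation piP' := (\pi_P' : S' -> P').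
Local Notation L := (line_total R chi k).
Local Notation piL := (\pi_L : (S * C)%type -> L).

Let chi_pos : weight_vector chi. Proof. by move=> i; exact: chi'_pos. Qed.

Let chi_k i : (chi i %| k)%N.
Proof. by apply: divisive_dvdn => //; rewrite leq_ord. Qed.

Definition append (z : 'rV[C]_n.+1) (w : C) : 'rV[C]_n.+2 :=
  \row_j oapp (z 0) w (unlift ord_max j).

Lemma append_lift z w i : append z w 0 (lift ord_max i) = z 0 i.
Proof. by rewrite mxE liftK. Qed.

Lemma append_max z w : append z w 0 ord_max = w.
Proof. by rewrite mxE unlift_none. Qed.

Lemma append_act t z w : weighted_act chi' t (append z w) =
  append (weighted_act chi t z) (t ^+ k * w).
Proof.
apply/rowP => j; rewrite mxE; case: (unliftP ord_max j) => [i|] ->.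
  by rewrite !append_lift mxE.
by rewrite !append_max.
Qed.

Lemma sum_lift_max (f : 'I_n.+2 -> C) :
  \sum_j f j = \sum_i f (lift ord_max i) + f ord_max.
Proof.
rewrite big_ord_recr; congr (_ + _); apply: eq_bigr => i _; congr f.
by apply: val_inj; rewrite /= /bump leqNgt ltn_ord.
Qed.

Lemma append_in_sphere z w : unit_sphere R n.+1 (append z w) <->
  \sum_i `|z 0 i| ^+ 2 + `|w| ^+ 2 = 1.
Proof.
rewrite /unit_sphere /= sum_lift_max append_max.
by rewrite (eq_bigr (fun i => `|z 0 i| ^+ 2))// => i _; rewrite append_lift.
Qed.

(* Rational parametrisation [((1 - a^2) / (1 + a^2), 2 a / (1 + a^2))] of the
   quarter circle, used instead of [(sqrt (1 - a^2), a)]. *)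
Definition thom_height (u : C) : C := (1 - `|u| ^+ 2) / (1 + `|u| ^+ 2).

Definition thom_vector (p : S * C) : 'rV[C]_n.+2 :=
  append (thom_height p.2 *: set_val p.1) (p.2 *+ 2 / (1 + `|p.2| ^+ 2)).

Lemma norm2_gt0 (u : C) : 0 < 1 + `|u| ^+ 2.
Proof. by rewrite ltr_pwDl// exprn_ge0. Qed.

Lemma thom_height_real u : thom_height u \is Num.real.
Proof.
by rewrite rpred_div// ?rpredB ?rpredD ?rpred1// rpredX// normr_real.
Qed.

Lemma thom_height_ge0 u : `|u| <= 1 -> 0 <= thom_height u.
Proof.
move=> u1; rewrite divr_ge0 ?(ltW (norm2_gt0 u))// subr_ge0.
by rewrite expr_le1.
Qed.

(** This is (1 - a^2)^2 + (2a)^2 = (1 + a^2)^2 with a = |u|. *)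
Lemma thom_vector_in_sphere p : unit_sphere R n.+1 (thom_vector p).
Proof.
case: p => z u; apply/append_in_sphere => /=.
under eq_bigr do rewrite mxE normrM exprMn.
rewrite -mulr_sumr (set_valP z) mulr1 real_normK ?thom_height_real//.
rewrite /thom_height normrM normfV (ger0_norm (ltW (norm2_gt0 u))) normrMn.
have := lt0r_neq0 (norm2_gt0 u); set a := `|u| => a0.
by field.
Qed.

Definition thom_rep (p : S * C) : P' := piP' (in_sphere (thom_vector_in_sphere p)).

Lemma thom_rep_continuous : continuous thom_rep.
Proof.
move=> p; apply: (@continuous_at_comp _ _ _ _
  (fun p => in_sphere (thom_vector_in_sphere p)) piP'); last first.
  exact: piP_continuous.
move: p; apply: sphere_continuous => j p.
have cu : continuous_at p (fun p : S * C => p.2) by exact: cvg_snd.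
have ca : continuous_at p (fun p : S * C => (1 + `|p.2| ^+ 2)^-1).
  apply: continuous_atV; first by rewrite gt_eqF// norm2_gt0.
  apply: continuous_atD; first exact: continuous_at_cst.
  by apply: continuous_atX; exact: continuous_at_norm.
case: (unliftP ord_max j) => [i|] ->.
  apply: (@eq_continuous_at (S * C)%type C
    (fun p => thom_height p.2 * set_val p.1 0 i)) => [q|].
    by rewrite /= append_lift mxE.
  apply: continuous_atM; last first.
    apply: (@continuous_at_comp _ _ _ _ fst (fun z : S => set_val z 0 i)).
      exact: cvg_fst.
    exact: sphere_coord_continuous.
  apply: continuous_atM ca; apply: continuous_atB; first exact: continuous_at_cst.
  by apply: continuous_atX; exact: continuous_at_norm.
apply: (@eq_continuous_at (S * C)%type C
  (fun p => p.2 * 2 * (1 + `|p.2| ^+ 2)^-1)) => [q|].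
  by rewrite /= append_max mulr_natr.
by apply: continuous_atM ca; apply: continuous_atM cu _; exact: continuous_at_cst.
Qed.

Lemma thom_vector_act t (t1 : `|t| = 1) z u :
  thom_vector (sphere_act chi t1 z, t ^+ k * u) =
  weighted_act chi' t (thom_vector (z, u)).
Proof.
rewrite append_act /thom_vector /=.
rewrite /thom_height !normrM normrX t1 expr1n mul1r.
congr append; last by rewrite mulrA mulrnAr.
by apply/rowP => i; rewrite !mxE mulrCA.
Qed.

Definition thom_fun (e : L) : P' := thom_rep (repr e).

Lemma thom_funE p : thom_fun (piL p) = thom_rep p.
Proof.
rewrite /thom_fun line_descend// => t t1 z u; apply/esym/piP_eqP.
by exists t => //; exact/esym/thom_vector_act.
Qed.

Lemma thom_fun_continuous : continuous thom_fun.
Proof. exact: line_continuous thom_funE thom_rep_continuous. Qed.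

(** The length of [z, u] is |u|, which describes the disc and sphere bundles on representatives. *)
Lemma line_form_diag p : line_form (piL p) (piL p) = `|p.2| ^+ 2.
Proof.
rewrite (line_formE chi_k) /line_form_rep mulfK ?normCK//.
by rewrite gt_eqF// coord_pow_dot_gt0//; exact: chi'_pos.
Qed.

(** The height vanishes when |u| = 1, and T acts transitively on the unit circle through t^k because
    k > 0. *)
Lemma thom_rep_unit p q : `|p.2| = 1 -> `|q.2| = 1 -> thom_rep p = thom_rep q.
Proof.
move: p q => [z u] [w v] /= u1 v1; apply/piP_eqP.
have [t t1 tuv] : exists2 t : C, `|t| = 1 & t ^+ k = v / u.
  by apply: (unit_root (chi'_pos ord_max)); rewrite normf_div u1 v1 divr1.
exists t => //; rewrite !in_sphereE append_act /thom_vector /thom_height /=.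
rewrite u1 v1 expr1n subrr !mul0r !scale0r.
congr append; last by rewrite mulrA mulrnAr tuv divfK ?unit_neq0.
by apply/rowP => i; rewrite !mxE mulr0.
Qed.

(** The norm of the first block of coordinates gives the height, and the height determines |u|. The
    element [t] matching the images then matches the original points, provided the height by which
    one divides is nonzero. *)
Lemma thom_rep_inj p q : `|p.2| <= 1 -> `|q.2| <= 1 ->
  thom_rep p = thom_rep q -> piL p = piL q \/ `|p.2| = 1 /\ `|q.2| = 1.
Proof.
move: p q => [z u] [w v] /= u1 v1 /piP_eqP[t t1 tE].
have tzE i : t ^+ chi i * (thom_height u * set_val z 0 i) =
    thom_height v * set_val w 0 i.
  move/rowP : tE => /(_ (lift ord_max i)).
  by rewrite mxE !append_lift !mxE.
have tuE : t ^+ k * (u *+ 2 / (1 + `|u| ^+ 2)) = v *+ 2 / (1 + `|v| ^+ 2).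
  by move/rowP : tE => /(_ ord_max); rewrite mxE !append_max.
have sumE (x : S) (a s : C) : `|s| = 1 ->
    \sum_i `|s ^+ chi i * (a * set_val x 0 i)| ^+ 2 = `|a| ^+ 2.
  move=> s1; rewrite -[RHS]mulr1 -(set_valP x) mulr_sumr; apply: eq_bigr => i _.
  by rewrite !normrM normrX s1 expr1n mul1r exprMn.
have hE : thom_height u = thom_height v.
  apply/eqP; rewrite -(@eqrXn2 _ 2) ?thom_height_ge0//.
  rewrite -(ger0_norm (thom_height_ge0 u1)) -(ger0_norm (thom_height_ge0 v1)).
  (* Both heights become norms of the first block: the left one after acting by [t], the right one
     with the trivial element 1. *)
  rewrite -(sumE z _ t t1) -(sumE w _ 1 (normr1 _)); apply/eqP.
  by apply: eq_bigr => i _; rewrite tzE expr1n mul1r.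
have uvE : `|u| ^+ 2 = `|v| ^+ 2.
  have := hE; rewrite /thom_height.
  have := norm2_gt0 u; have := norm2_gt0 v.
  set a := `|u| ^+ 2; set b := `|v| ^+ 2 => b0 a0.
  move/eqP; rewrite eqr_div ?lt0r_neq0// => /eqP ab.
  (* Cross-multiplying equal heights leaves 2(a - b) = 0. *)
  apply: (mulIf (x := 2)); first by rewrite pnatr_eq0.
  apply/eqP; rewrite -subr_eq0; apply/eqP.
  transitivity ((1 - b) * (1 + a) - (1 - a) * (1 + b)); first by ring.
  by rewrite ab subrr.
have [v11|v11] := eqVneq (`|v| ^+ 2) 1.
  by right; split; apply/eqP; rewrite -(@pexpr_eq1 _ _ 2)// ?uvE v11.
left; apply/piL_eqP; exists t => //; split; last first.
  apply: (mulIf (x := 2 / (1 + `|v| ^+ 2))).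
    by rewrite mulf_neq0 ?invr_neq0 ?pnatr_eq0// gt_eqF// norm2_gt0.
  by move: tuE; rewrite uvE -(mulr_natr u) -(mulr_natr v) !mulrA.
apply/rowP => i; rewrite mxE /=; apply: (mulfI (x := thom_height v)).
  by rewrite mulf_neq0 ?invr_neq0 ?(lt0r_neq0 (norm2_gt0 v))// subr_eq0 eq_sym.
by rewrite -tzE hE mulrCA.
Qed.

(** The rational parametrisation is inverted by stereographic projection: a point with first block
    of norm r and last coordinate w comes from u = w / (1 + r), whose height is r. *)
Lemma thom_rep_surj x : exists2 p, `|p.2| <= 1 & thom_rep p = x.
Proof.
have [y <-] := piPK x.
pose y0 i := set_val y 0 (lift ord_max i); pose w := set_val y 0 ord_max.
have yE : \sum_i `|y0 i| ^+ 2 + `|w| ^+ 2 = 1.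
  by rewrite -(set_valP y) sum_lift_max.
pose r := sqrtC (\sum_i `|y0 i| ^+ 2).
have r0 : 0 <= r by rewrite sqrtC_ge0 sumr_ge0// => i _; rewrite exprn_ge0.
have rE : r ^+ 2 = \sum_i `|y0 i| ^+ 2 by rewrite sqrtCK.
(* The direction of the first block is y0 / r; if r = 0 the block vanishes and any unit vector will
   do. *)
have [z zE] : exists z : S, forall i, r * set_val z 0 i = y0 i.
  have [r00|r00] := eqVneq r 0.
    have Se : unit_sphere R n (delta_mx 0 0).
      rewrite /unit_sphere /= (bigD1 0)//= big1 => [|i i0].
        by rewrite mxE !eqxx normr1 expr1n addr0.
      by rewrite mxE (negbTE i0) andbF normr0 expr0n.
    exists (in_sphere Se) => i; rewrite r00 mul0r; apply/esym/eqP.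
    have := rE; rewrite r00 expr0n /= => /esym/eqP.
    rewrite psumr_eq0 => [/allP/(_ i (mem_index_enum _))|j _]; last exact: exprn_ge0.
    by rewrite expf_eq0 normr_eq0.
  have Sz : unit_sphere R n (\row_i (y0 i / r)).
    rewrite /unit_sphere /= (eq_bigr (fun i => `|y0 i| ^+ 2 / r ^+ 2)) => [|i _].
      by rewrite -mulr_suml -rE divff// expf_neq0.
    by rewrite mxE normf_div (ger0_norm r0) expr_div_n.
  by exists (in_sphere Sz) => i; rewrite mxE mulrC divfK.
have r1 : 0 < 1 + r by rewrite ltr_pwDl.
have uE : `|w / (1 + r)| ^+ 2 = (1 - r) / (1 + r).
  rewrite normf_div (ger0_norm (ltW r1)) expr_div_n.
  have -> : `|w| ^+ 2 = 1 - r ^+ 2 by rewrite rE -yE addrAC subrr add0r.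
  by field; rewrite gt_eqF.
have u1E : 1 + `|w / (1 + r)| ^+ 2 = 2 / (1 + r).
  by rewrite uE; field; rewrite gt_eqF.
exists (z, w / (1 + r)) => /=.
  rewrite -(@expr_le1 _ 2)// uE ler_pdivrMr// mul1r lerD2l.
  by apply: (le_trans _ r0); rewrite oppr_le0.
rewrite /thom_rep; congr piP'; apply/val_inj/rowP => j.
case: (unliftP ord_max j) => [i|] ->.
  rewrite /= append_lift mxE -[RHS]zE; congr (_ * _).
  rewrite /thom_height u1E uE; field.
  by rewrite gt_eqF.
rewrite /= append_max /= u1E -/w; field.
by rewrite gt_eqF.
Qed.

(** * The homeomorphism from the Thom space *)

Variables (B : topologicalType) (h : B -> P) (h' : P -> B).
Hypotheses (ch : continuous h) (ch' : continuous h').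
Hypotheses (hK : cancel h h') (h'K : cancel h' h).

Local Notation g :=
  (line_metric chi_pos (chi'_pos ord_max) chi_k ch ch' hK h'K).
Local Notation D := (unit_disc_bundle g).
Local Notation T := (thom_space g).
Local Notation piT := (\pi_T : D -> T).

Lemma unit_disc_bundleE p : D (piL p) <-> `|p.2| <= 1.
Proof.
by rewrite /unit_disc_bundle /= line_form_diag expr_le1.
Qed.

Lemma unit_disc_bundle_compact : compact D.
Proof.
have -> : D = piL @` ([set: S] `*` [set u | `|u| <= 1]).
  apply/seteqP; split=> [e|_ [[z u] [_ u1] <-]]; last exact/unit_disc_bundleE.
  by rewrite -[e]reprK => /unit_disc_bundleE e1; exists (repr e).
apply: continuous_compact (continuous_subspaceT (@piL_continuous _ _ _ _)) _.
by apply: compact_setX; [exact: compact_sphere|exact: compact_disc].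
Qed.

Lemma thom_space_compact : compact [set: T].
Proof.
apply: (compact_setT_image (f := piT) (compact_set_type unit_disc_bundle_compact)).
  exact: pi_continuous.
by apply/seteqP; split=> // x _; exists (repr x) => //; exact: reprK.
Qed.

Definition thom_homeo (x : T) : P' := thom_fun (set_val (repr x)).

Lemma unit_sphere_bundleE (e : D) p : set_val e = piL p ->
  e \in @unit_sphere_bundle _ _ _ _ g = (`|p.2| == 1).
Proof.
move=> ep; rewrite -(@pexpr_eq1 _ _ 2)// -line_form_diag -ep.
by apply/idP/eqP; rewrite inE.
Qed.

(** Distinct representatives of a point of the quotient both lie in the sphere bundle, where
    [thom_rep_unit] makes the map constant. *)
Lemma thom_homeoE e : thom_homeo (piT e) = thom_fun (set_val e).
Proof.
have /pi_quotient_eqP/orP[/eqP{2}->//|] : piT e = piT (repr (piT e)).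
  by rewrite reprK.
rewrite /thom_homeo; move: (repr _) => e'.
case/andP.
have [p ep] : exists p, set_val e = piL p.
  by exists (repr (set_val e)); rewrite reprK.
have [q eq] : exists q, set_val e' = piL q.
  by exists (repr (set_val e')); rewrite reprK.
rewrite ep eq !thom_funE (unit_sphere_bundleE ep) (unit_sphere_bundleE eq).
by move=> /eqP p1 /eqP q1; exact: thom_rep_unit.
Qed.

Lemma thom_homeo_inj : injective thom_homeo.
Proof.
move=> x y; rewrite -[x]reprK -[y]reprK !thom_homeoE.
move: (repr x) (repr y) => e e' {x y} ee'.
have [p ep] : exists p, set_val e = piL p.
  by exists (repr (set_val e)); rewrite reprK.
have [q eq] : exists q, set_val e' = piL q.
  by exists (repr (set_val e')); rewrite reprK.
have p1 : `|p.2| <= 1 by apply/unit_disc_bundleE; rewrite -ep; exact: set_valP.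
have q1 : `|q.2| <= 1 by apply/unit_disc_bundleE; rewrite -eq; exact: set_valP.
move: ee'; rewrite ep eq !thom_funE => /(thom_rep_inj p1 q1)[pq|[p11 q11]].
  by congr piT; apply: val_inj; rewrite -!set_valE ep eq.
apply/pi_quotient_eqP/orP; right.
by rewrite (unit_sphere_bundleE ep) (unit_sphere_bundleE eq) p11 q11 eqxx.
Qed.

Lemma thom_homeomorphic : homeomorphic P' T.
Proof.
apply: homeomorphic_sym.
refine (@compact_bij_homeomorphic _ _ thom_homeo thom_space_compact _ _ _ _).
- exact: weighted_projective_space_hausdorff.
- apply/quotient_continuous.
  rewrite (_ : _ \o _ = thom_fun \o set_val); last first.
    by apply/funext => e; exact: thom_homeoE.
  move=> e; apply: (@continuous_comp _ _ _ set_val thom_fun).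
    exact: initial_continuous.
  exact: thom_fun_continuous.
- exact: thom_homeo_inj.
- move=> x; have [p p1 <-] := thom_rep_surj x.
  exists (piT (exist _ (piL p) (mem_set ((unit_disc_bundleE p).2 p1)))).
  by rewrite thom_homeoE thom_funE.
Qed.

End ThomSpaceOfLineBundle.

(** * The tower of Thom spaces *)

Lemma weighted_projective_space_thom (R : realType) n (chi : 'I_n.+2 -> nat)
    (B : topologicalType) : weight_vector chi -> divisive chi ->
  homeomorphic B (weighted_projective_space R (fun i => chi (lift ord_max i))) ->
  exists (theta : complex_line_bundle R B) (g : hermitian_metric theta),
    homeomorphic (weighted_projective_space R chi) (thom_space g).
Proof.
move=> chi_pos chi_div [h [h' [ch ch' hK h'K]]].
by eexists; eexists; exact: (thom_homeomorphic chi_pos chi_div ch ch' hK h'K).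
Qed.

(** The sphere is the unit circle, on which T acts transitively through t^(chi_0). *)
Lemma weighted_projective_space_point (R : realType) (chi : 'I_1 -> nat) :
  weight_vector chi -> homeomorphic one_point (weighted_projective_space R chi).
Proof.
move=> chi_pos.
have S1 : unit_sphere R 0 (const_mx 1).
  by rewrite /unit_sphere /= big_ord1 mxE normr1 expr1n.
pose x0 : weighted_projective_space R chi :=
  \pi_(weighted_projective_space R chi) (in_sphere S1).
exists (fun=> x0), (fun=> tt); split=> [||[]//|x].
- by move=> ?; exact: continuous_at_cst.
- by move=> ?; exact: continuous_at_cst.
rewrite -[x]reprK; apply/piP_eqP; move: (repr x) => z.
have z1 : `|set_val z 0 0| = 1.
  apply/eqP; rewrite -(@pexpr_eq1 _ _ 2)//; apply/eqP.
  by have := set_valP z; rewrite /unit_sphere /= big_ord1.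
have [t t1 tz] := unit_root (chi_pos ord0) z1.
by exists t => //; apply/rowP => i; rewrite !mxE mulr1 !ord1.
Qed.

Theorem corollary3p8 (R : realType) (n : nat) (chi : 'I_n.+1 -> nat)
  (chi_pos : weight_vector chi) (chi_div : divisive chi) :
  exists2 Y : topologicalType,
    iterated_thom_space_of_line_bundles R n one_point Y &
    homeomorphic (weighted_projective_space R chi) Y.
Proof.
(* Capping the index at [n] repeats the last weight forever, so that a weight vector of length m + 1
   exists for every natural number [m]. *)
pose c m (j : 'I_m.+1) := chi (inord (minn j n)).
pose P m : topologicalType := weighted_projective_space R (@c m).
(* The tower must start at [one_point] up to equality, not just homeomorphism, so stage 0 is
   replaced. *)
pose X m := if m is 0 then one_point else P m.
have c_pos m : weight_vector (@c m) by move=> j; exact: chi_pos.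
have c_div m : divisive (@c m).
  (* From index [n] on, consecutive weights are equal; before it, divisibility is that of [chi]. *)
  move=> i j ij; rewrite /c; case: (boolP (n <= i)%N) => [ni|].
    by rewrite (minn_idPr ni) (minn_idPr _) ?dvdnn// ij leqW.
  rewrite -ltnNge => ni; apply: chi_div.
  by rewrite (minn_idPl _) ?ij// (minn_idPl (ltnW ni)) !inordK// ltnW.
have XP m : homeomorphic (X m) (P m).
  case: m => [|m]; first exact: weighted_projective_space_point.
  by exists id, id; split=> //; move=> x; exact: continuous_at_id.
have c_n : @c n = chi.
  by apply/funext => j; rewrite /c (minn_idPl _) ?inord_val// -ltnS.
exists (X n); last by rewrite -c_n; apply: homeomorphic_sym; exact: XP.
exists X; split=> // i _; apply: weighted_projective_space_thom => //.
(* Dropping the last weight of one stage gives the weights of the previous stage. *)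
have -> : (fun j => @c i.+1 (lift ord_max j)) = @c i.
  by apply/funext => j; rewrite /c lift_max.
exact: XP.
Qed.
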